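(* For every $n\geq 1$, the order implication $$x\Rightarrow_c y=\begin{cases}1&\text{if }x\leq y\\ 0&\text{otherwise}\end{cases}$$ and the Gödel implication $$x\Rightarrow_G y=\begin{cases}1&\text{if }x\leq y\\ y&\text{otherwise}\end{cases}$$ are both definable in $\mathbf{L}^*_{n+1}$.
   Context: For $n\ge 1$, $\mathbf{L}^*_{n+1}=(L_{n+1},\vee,*,\neg,0,1)$ is the algebra with universe $L_{n+1}=\{0,1/n,\ldots,(n-1)/n,1\}$ and operations $x\vee y=\max\{x,y\}$, $*x=\max\{0,2x-1\}$, $\neg x=1-x$. An operation on $L_{n+1}$ is definable in $\mathbf{L}^*_{n+1}$ if it is a term operation of $\mathbf{L}^*_{n+1}$. *)

(* Defs.v *)
From HB Require Import structures.
From mathcomp Require Import all_boot all_order all_algebra.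
Set Implicit Arguments.
Unset Strict Implicit.
Unset Printing Implicit Defensive.
Import Order.TTheory GRing.Theory Num.Theory.
Local Open Scope ring_scope.

(* Algebras of the signature (join, star, neg, 0, 1) of type (2, 1, 1, 0, 0). *)
Record star_algebra := StarAlgebra {
  carrier :> Type;
  join : carrier -> carrier -> carrier;
  star : carrier -> carrier;
  neg : carrier -> carrier;
  zero : carrier;
  one : carrier }.

Inductive term (k : nat) :=
  | Var of 'I_k
  | Join of term k & term k
  | Star of term k
  | Neg of term k
  | Zero
  | One.

Fixpoint eval (A : star_algebra) (k : nat) (v : k.-tuple A) (t : term k) : A :=
  match t with
  | Var i => tnth v i
  | Join t1 t2 => join (eval v t1) (eval v t2)
  | Star t1 => star (eval v t1)
  | Neg t1 => neg (eval v t1)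
  | Zero => zero A
  | One => one A
  end.

Definition term_operation (A : star_algebra) (k : nat) (f : k.-tuple A -> A) :=
  exists t : term k, forall v : k.-tuple A, f v = eval v t.

Definition definable2 (A : star_algebra) (f : A -> A -> A) :=
  term_operation (fun v : 2.-tuple A => f (tnth v ord0) (tnth v ord_max)).

Definition in_L (n : nat) : pred rat :=
  fun x => [exists i : 'I_n.+1, x == i%:R / n%:R].

(* The universe L_{n+1} = {0, 1/n, ..., 1}; it has n + 1 elements if 0 < n. *)
Definition L (n : nat) := {x : rat | in_L n x}.

Lemma in_L_frac (n i : nat) : (i <= n)%N -> in_L n (i%:R / n%:R).
Proof. by move=> le_in; apply/existsP; exists (Ordinal (le_in : (i < n.+1)%N)). Qed.

Lemma in_L_max (n : nat) (x y : L n) : in_L n (Num.max (val x) (val y)).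
Proof. by rewrite maxEle; case: ifP => _; apply: valP. Qed.

Lemma in_L0 (n : nat) : in_L n 0.
Proof. by have := in_L_frac (leq0n n); rewrite mul0r. Qed.

Lemma in_L1 (n : nat) (hn : (0 < n)%N) : in_L n 1.
Proof. by have := in_L_frac (leqnn n); rewrite divff // pnatr_eq0 -lt0n. Qed.

Lemma in_L_neg (n : nat) (hn : (0 < n)%N) (x : L n) : in_L n (1 - val x).
Proof.
case: x => x /= /existsP[i /eqP->].
have n0 : n%:R != 0 :> rat by rewrite pnatr_eq0 -lt0n.
have le_in : (i <= n)%N by rewrite -ltnS.
by have := in_L_frac (leq_subr i n); rewrite natrB // mulrBl divff.
Qed.

Lemma in_L_star (n : nat) (hn : (0 < n)%N) (x : L n) :
  in_L n (Num.max 0 (2 * val x - 1)).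
Proof.
case: x => x /= /existsP[i /eqP->].
have n0 : n%:R != 0 :> rat by rewrite pnatr_eq0 -lt0n.
have le_in : (i <= n)%N by rewrite -ltnS.
rewrite maxEle; case: ifP => [h|_]; last exact: in_L0.
have eq1 : 2 * (i%:R / n%:R) - 1 = ((2 * i)%:R - n%:R) / n%:R :> rat.
  by rewrite mulrBl divff // natrM mulrA.
have le_n2i : (n <= 2 * i)%N.
  by move: h; rewrite eq1 pmulr_lge0 ?invr_gt0 ?ltr0n // subr_ge0 ler_nat.
rewrite eq1 -natrB //; apply: in_L_frac.
by rewrite leq_subLR mul2n -addnn leq_add.
Qed.

Definition Lstar (n : nat) (hn : (0 < n)%N) : star_algebra :=
  {| carrier := L n;
     join := fun x y => exist _ (Num.max (val x) (val y)) (in_L_max x y);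
     star := fun x => exist _ (Num.max 0 (2 * val x - 1)) (in_L_star hn x);
     neg := fun x => exist _ (1 - val x) (in_L_neg hn x);
     zero := exist _ 0 (in_L0 n);
     one := exist _ 1 (in_L1 hn) |}.

Definition order_imp (n : nat) (hn : (0 < n)%N) (x y : Lstar hn) : Lstar hn :=
  if (val (x : L n) <= val (y : L n) :> rat) then one (Lstar hn)
  else zero (Lstar hn).

Definition godel_imp (n : nat) (hn : (0 < n)%N) (x y : Lstar hn) : Lstar hn :=
  if (val (x : L n) <= val (y : L n) :> rat) then one (Lstar hn) else y.

(* Main.v *)
Require Import Defs.
From mathcomp Require Import all_boot all_order all_algebra.
From mathcomp Require Import lra.

(** Star is the map x |-> 2x - 1 truncated below at 0, and its dual
    x |-> neg (star (neg x)) is x |-> 2x truncated above at 1.  Composing k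
    of these maps in any order gives x |-> 2^k x - c truncated to [0, 1],
    where the binary digits of c record which map is used at each step
    ([evalq_zoom]).  Its graph climbs from 0 to 1 on the dyadic interval
    [c / 2^k, (c + 1) / 2^k].  As soon as 2^k >= 2n, every step
    [a / n, (a + 1) / n] of the chain is long enough to contain such an
    interval, so the characteristic function of {x | a / n < x} is a term
    operation ([evalq_above]).

    On the values 0 and 1, join and neg are the Boolean connectives, and x <= y
    means that a / n < x implies a / n < y for each of the finitely many a < n;
    the conjunction of these implications is a term for the order implication.
    Its join with y is the Goedel implication: it gives 1 where x <= y, and
    0 joined with y elsewhere. *)

Set Implicit Arguments.
Unset Strict Implicit.
Unset Printing Implicit Defensive.
Import Order.TTheory GRing.Theory Num.Theory.

Section Truncation.
Local Open Scope ring_scope.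

Definition clip (z : rat) : rat := Num.max 0 (Num.min 1 z).

Lemma clip_id z : 0 <= z <= 1 -> clip z = z.
Proof. by move=> /andP[z0 z1]; rewrite /clip min_r // max_r. Qed.

Lemma clip_le0 z : z <= 0 -> clip z = 0.
Proof. by move=> z0; rewrite /clip max_l // ge_min z0 orbT. Qed.

Lemma clip_ge1 z : 1 <= z -> clip z = 1.
Proof. by move=> z1; rewrite /clip min_l // max_r. Qed.

(** Both z |-> 2z - 1 and z |-> 2z map ]-oo, 0] to itself and [1, +oo[ to itself,
    so truncating before doubling changes nothing once the result is
    truncated. *)
Lemma star_clip z : Num.max 0 (2 * clip z - 1) = clip (2 * z - 1).
Proof.
have [z0|z0] := leP z 0; first by rewrite !clip_le0 ?max_l //; lra.
have [z1|z1] := leP 1 z; first by rewrite !clip_ge1 ?max_r //; lra.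
by rewrite (@clip_id z) ?ltW // /clip min_r //; lra.
Qed.

Lemma dual_star_clip z :
  1 - Num.max 0 (2 * (1 - clip z) - 1) = clip (2 * z).
Proof.
have clipN y : 1 - clip y = clip (1 - y).
  have [y0|y0] := leP y 0; first by rewrite clip_le0 // clip_ge1 ?subr0 //; lra.
  have [y1|y1] := leP 1 y; first by rewrite clip_ge1 // clip_le0 ?subrr //; lra.
  by rewrite !clip_id //; lra.
by rewrite clipN star_clip clipN; congr clip; lra.
Qed.

End Truncation.

Section Terms.
Local Open Scope ring_scope.
Variables (n : nat) (hn : (0 < n)%N) (k : nat).
Implicit Types (v : k.-tuple (Lstar hn)) (t : term k).

Definition evalq v t : rat := val (eval v t : L n).

Lemma evalq_frac v t : exists2 i, (i <= n)%N & evalq v t = i%:R / n%:R.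
Proof.
have /existsP[i /eqP vt] := valP (eval v t : L n).
by exists (val i); first by rewrite -ltnS; exact: ltn_ord.
Qed.

Lemma evalq_itv v t : 0 <= evalq v t <= 1.
Proof.
have [i le_in ->] := evalq_frac v t.
by rewrite divr_ge0 ?ler0n //= ler_pdivrMr ?ltr0n // mul1r ler_nat.
Qed.

(** The outermost map is selected by the lowest binary digit of [c].  Digits
    beyond the first [m] would shift the whole unit interval below 0, which is
    why the base case sends a nonzero [c] to [Zero]. *)
Fixpoint zoom (m c : nat) (t : term k) : term k :=
  if m is m'.+1 then
    let s := zoom m' c./2 t in if odd c then Star s else Neg (Star (Neg s))
  else if c is 0%N then t else Zero k.

Lemma evalq_zoom v m c t :
  evalq v (zoom m c t) = clip ((2 ^ m)%:R * evalq v t - c%:R).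
Proof.
elim: m c => [|m IHm] c /=.
  case: c => [|c]; first by rewrite mul1r subr0 clip_id ?evalq_itv.
  rewrite clip_le0 // mul1r -natr1.
  have /andP[_ ?] := evalq_itv v t.
  have : 0 <= c%:R :> rat by exact: ler0n.
  lra.
have -> : (2 ^ m.+1)%:R * evalq v t - c%:R =
    2 * ((2 ^ m)%:R * evalq v t - c./2%:R) - (odd c)%:R.
  rewrite -[in LHS](odd_double_half c) expnS -mul2n natrD !natrM.
  lra.
case: (odd c); rewrite /evalq /= -/(evalq v _) IHm.
  exact: star_clip.
by rewrite dual_star_clip subr0.
Qed.

(** Since 2^(n+1) >= 2n, a dyadic interval of length 1 / 2^(n+1) is at most half
    a step of the chain, so the first one that starts after a / n ends no
    later than (a + 1) / n. *)
Definition above (a : nat) (t : term k) : term k :=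
  zoom n.+1 ((2 ^ n.+1 * a) %/ n).+1 t.

Lemma evalq_above v a t :
  evalq v (above a t) = (a%:R / n%:R < evalq v t)%R%:R.
Proof.
have n_gt0 : 0 < n%:R :> rat by rewrite ltr0n.
have [i le_in vt] := evalq_frac v t.
rewrite evalq_zoom vt ltr_pM2r ?invr_gt0 // ltr_nat.
set m := (2 ^ n.+1)%N; set q := ((m * a) %/ n)%N.
have le_2n_m : (2 * n <= m)%N by rewrite /m expnS leq_mul2l ltnW // ltn_expl.
rewrite mulrA -natrM; case: ltnP => [lt_ai|le_ia].
- (* [q.+2 * n <= m * a.+1]: the floor gives [q * n <= m * a], and the two
     extra steps of length [n] fit in the extra [m]. *)
  apply: clip_ge1; rewrite lerBrDr ler_pdivlMr // nat1r -natrM ler_nat.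
  have le_qn : (q * n <= m * a)%N by exact: leq_divM.
  apply: (@leq_trans (m * a.+1)); last by rewrite leq_mul2l lt_ai orbT.
  by rewrite -addn2 mulnDl mulnS addnC leq_add.
- apply: clip_le0; rewrite subr_le0 ler_pdivrMr // -natrM ler_nat.
  apply: (@leq_trans (m * a)); first by rewrite leq_mul2l le_ia orbT.
  by rewrite ltnW // ltn_ceil.
Qed.

Lemma evalq_neg_bool v t (b : bool) :
  evalq v t = b%:R -> evalq v (Neg t) = (~~ b)%:R.
Proof.
by rewrite /evalq /= => ->; case: b; rewrite ?subrr ?subr0.
Qed.

Lemma evalq_join_bool v s t (b c : bool) :
  evalq v s = b%:R -> evalq v t = c%:R -> evalq v (Join s t) = (b || c)%:R.
Proof.
by rewrite /evalq /= => -> ->; case: b; case: c; rewrite maxEle ?lexx ?ler01.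
Qed.

Definition conj_terms (ts : seq (term k)) : term k :=
  Neg (foldr (fun t => Join (Neg t)) (Zero k) ts).

Lemma evalq_conj (I : Type) v (f : I -> term k) (p : pred I) (r : seq I) :
  (forall a, evalq v (f a) = (p a)%:R) ->
  evalq v (conj_terms (map f r)) = (all p r)%:R.
Proof.
move=> fp; rewrite -[all p r]negbK; apply: evalq_neg_bool.
elim: r => //= a r IHr; rewrite negb_and.
by apply: evalq_join_bool => //; apply: evalq_neg_bool.
Qed.

Definition order_term (s t : term k) : term k :=
  conj_terms [seq Join (Neg (above a s)) (above a t) | a <- iota 0 n].

(** If t < s in value, then the value of t is itself a threshold a / n with
    a < n, and it separates the two. *)
Lemma evalq_order v s t :
  evalq v (order_term s t) = (evalq v s <= evalq v t)%R%:R.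
Proof.
have n_gt0 : 0 < n%:R :> rat by rewrite ltr0n.
rewrite (evalq_conj (p := fun a : nat =>
  (a%:R / n%:R < evalq v s) ==> (a%:R / n%:R < evalq v t))); last first.
  move=> a; rewrite implybE; apply: evalq_join_bool; last exact: evalq_above.
  by apply: evalq_neg_bool; exact: evalq_above.
congr (nat_of_bool _)%:R; apply/allP/idP => [imp|le_st a _]; last first.
  by apply/implyP => /lt_le_trans; apply.
rewrite leNgt; apply/negP => lt_ts.
have [i le_in vs] := evalq_frac v s; have [j _ vt] := evalq_frac v t.
have lt_ji : (j < i)%N.
  by move: lt_ts; rewrite vs vt ltr_pM2r ?invr_gt0 // ltr_nat.
have := imp j; rewrite mem_iota (leq_trans lt_ji) // => /(_ isT).
by rewrite -vt lt_ts ltxx.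
Qed.

End Terms.

Theorem proposition3p13 (n : nat) (hn : 0 < n) :
  definable2 (@order_imp n hn) /\ definable2 (@godel_imp n hn).
Proof.
pose x := Var (ord0 : 'I_2); pose y := Var (ord_max : 'I_2).
split; [exists (order_term n x y) | exists (Join (order_term n x y) y)].
- move=> v; apply: val_inj; rewrite -/(evalq v _) evalq_order.
  by rewrite /order_imp /evalq /=; case: ifP.
- move=> v; apply: val_inj.
  have -> : val (eval v (Join (order_term n x y) y) : L n) =
      Num.max (evalq v (order_term n x y)) (evalq v y) by [].
  have /andP[y_ge0 y_le1] := evalq_itv v y.
  rewrite evalq_order /godel_imp -/(evalq v x) -/(evalq v y).
  by case: ifP => _; [rewrite max_l | rewrite max_r].
Qed.
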